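(* Let $\Lambda$ be a ring and let $d$ be a function assigning to every $\Lambda$-module an element of $\{0,1,2,\dots\}\cup\{\infty\}$. Let $i$ be a nonnegative integer and $0\to K\to L^{0}\to L^{1}\to\cdots\to L^{i}\to N\to0$ an exact sequence of $\Lambda$-modules. Then the following hold. (1) If $d$ satisfies $(\widetilde{d1})$ (resp. (d1)) and $d(K)-j<d(L^{j})$ for $0\le j\le i$, then $d(K)\ge d(N)+i+1$ (resp. $d(K)=d(N)+i+1$). (2) If $d$ satisfies (d2) and $d(N)+i-j<d(L^{j})$ for $0\le j\le i$, then $d(K)=d(N)+i+1$.
   Context: Conditions on a function $d$ from $\Lambda$-modules to $\{0,1,\dots\}\cup\{\infty\}$, required for every short exact sequence $0\to K\to L\to N\to0$ of $\Lambda$-modules: $(\widetilde{d1})$ if $d(L)>d(K)$, then $d(K)\ge d(N)+1$; (d1) if $d(L)>d(K)$, then $d(K)=d(N)+1$; (d2) if $d(L)>d(N)$, then $d(K)=d(N)+1$. *)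

(* Defs.v *)
From HB Require Import structures.
From mathcomp Require Export all_boot all_order all_algebra.
From mathcomp Require Export constructive_ereal.

Set Implicit Arguments.
Unset Strict Implicit.
Unset Printing Implicit Defensive.

Local Open Scope ring_scope.
Local Open Scope ereal_scope.

Section Exactness.
Variable R : pzRingType.

Definition surjective_map (M M' : Type) (f : M -> M') : Prop :=
  forall y, exists x, f x = y.

Definition exact_at (A B C : lmodType R)
    (f : {linear A -> B}) (g : {linear B -> C}) : Prop :=
  forall y : B, g y = 0%R <-> exists x : A, f x = y.

Definition short_exact (K L N : lmodType R)
    (f : {linear K -> L}) (g : {linear L -> N}) : Prop :=
  [/\ injective f, exact_at f g & surjective_map g].

(* Exactness of 0 -> X 0 -> X 1 -> ... -> X m -> 0, where f n : X n -> X n.+1.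
   Terms and maps beyond X m are unconstrained: a family indexed by all of nat
   keeps the codomain of f n convertible to the domain of f n.+1. *)
Definition exact_sequence (m : nat) (X : nat -> lmodType R)
    (f : forall n, {linear X n -> X n.+1}) : Prop :=
  [/\ injective (f 0%N),
      forall n, (n.+1 < m)%N -> exact_at (f n) (f n.+1)
    & forall n, n.+1 = m -> surjective_map (f n)].

End Exactness.

Section Conditions.
Variables (R : pzRingType) (d : lmodType R -> \bar int).

Definition cond_d1_tilde : Prop :=
  forall (K L N : lmodType R) (f : {linear K -> L}) (g : {linear L -> N}),
    short_exact f g -> d K < d L -> d N + 1%:E <= d K.

Definition cond_d1 : Prop :=
  forall (K L N : lmodType R) (f : {linear K -> L}) (g : {linear L -> N}),
    short_exact f g -> d K < d L -> d K = d N + 1%:E.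

Definition cond_d2 : Prop :=
  forall (K L N : lmodType R) (f : {linear K -> L}) (g : {linear L -> N}),
    short_exact f g -> d N < d L -> d K = d N + 1%:E.

End Conditions.

(* Main.v *)
Require Import Defs.
From HB Require Import structures.
From mathcomp Require Import all_boot all_order all_algebra.
From mathcomp Require Import constructive_ereal zify.
Import Order.TTheory GRing.Theory.

(** The sequence is cut at the kernel [Z] of [L^1 -> L^2], which splits off
    [0 -> K -> L^0 -> Z -> 0] and leaves a sequence of the same kind starting at
    [Z] and shorter by one term; both parts then follow by induction on [i]. *)

Set Implicit Arguments.
Unset Strict Implicit.
Unset Printing Implicit Defensive.

Local Open Scope ring_scope.
Local Open Scope ereal_scope.

Section Kernel.
Variables (R : pzRingType) (B C : lmodType R) (g : {linear B -> C}).

Definition lin_kernel : {pred B} := fun y => g y == 0%R.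

Fact lin_kernel_submod_closed : submod_closed lin_kernel.
Proof.
split=> [|a u v]; rewrite !unfold_in; first by rewrite linear0.
by move=> /eqP gu0 /eqP gv0; rewrite linearP gu0 gv0 scaler0 addr0.
Qed.

HB.instance Definition _ :=
  GRing.isSubmodClosed.Build R B lin_kernel lin_kernel_submod_closed.

(** The kernel has to be a module in its own right, since [d] takes modules as arguments. Packing it
    as a subtype of [B] lets the module structure be inherited and makes the inclusion [val] linear
    and injective. *)
Record kernel_type := KernelElt { kernel_val : B; _ : kernel_val \in lin_kernel }.

HB.instance Definition _ := [isSub for kernel_val].
HB.instance Definition _ := [Choice of kernel_type by <:].
HB.instance Definition _ := [SubChoice_isSubLmodule of kernel_type by <:].

Lemma kernel_valK (z : kernel_type) : g (val z) = 0%R.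
Proof. by apply/eqP; exact: (valP z). Qed.

Variables (A : lmodType R) (f : {linear A -> B}).
Hypothesis gf0 : forall x, g (f x) = 0%R.

Fact corestr_subproof x : f x \in lin_kernel.
Proof. by rewrite unfold_in gf0. Qed.

Definition corestr (x : A) : kernel_type := KernelElt (corestr_subproof x).

Fact corestr_is_linear : linear corestr.
Proof. by move=> a u v; apply: val_inj; rewrite linearP /= linearP. Qed.

HB.instance Definition _ :=
  GRing.isLinear.Build R A kernel_type _ corestr corestr_is_linear.

End Kernel.

Section Truncation.
Variables (R : pzRingType) (X : nat -> lmodType R).
Variable f : forall n, {linear X n -> X n.+1}.
Variables (Z : lmodType R) (e : {linear Z -> X 2%N}).

(** Matching on the index makes [trunc_obj n.+1] reduce to [X n.+2], so the old maps [f n.+2] fit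
    the new family without casts. *)
Definition trunc_obj (n : nat) : lmodType R := if n is n'.+1 then X n'.+2 else Z.

Definition trunc_map (n : nat) : {linear trunc_obj n -> trunc_obj n.+1} :=
  match n with 0 => e | n'.+1 => f n'.+2 end.

End Truncation.

(** [Z] is the kernel of [f 2], and [p] is [f 1] with its codomain restricted to [Z]. Exactness at
    [X 2] is what makes [p] surjective. The length [m.+3] guarantees that [X 2] is not the last
    term, so that exactness there is available. *)
Lemma exact_sequence_split (R : pzRingType) (X : nat -> lmodType R)
    (f : forall n, {linear X n -> X n.+1}) (m : nat) :
  exact_sequence m.+3 f ->
  exists (Z : lmodType R) (p : {linear X 1%N -> Z}) (e : {linear Z -> X 2%N}),
    short_exact (f 0%N) p /\ exact_sequence m.+2 (trunc_map f e).
Proof.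
move=> [f0_inj f_exact f_surj].
have ff0 x : f 2%N (f 1%N x) = 0%R by apply/(f_exact 1%N isT); exists x.
exists (kernel_type (f 2%N)), (corestr ff0),
  (\val : {linear kernel_type (f 2%N) -> X 2%N}).
split; split=> //.
(* The inclusion of [Z] is injective, so [p] and [f 1] have the same kernel. *)
- move=> y; rewrite -(f_exact 0%N isT); split=> [/(congr1 val)|fy0]; first by [].
  exact: val_inj.
- move=> z; have /(f_exact 1%N isT)[x fx] := kernel_valK z.
  by exists x; apply: val_inj.
- exact: val_inj.
(* Exactness at the term following [Z] is the definition of a kernel; later terms are those of the
   old sequence, one index up. *)
- case=> [|n] lt_nm y /=; last exact: (f_exact n.+2).
  split=> [/eqP fy0|[z <-]]; last exact: kernel_valK.
  by exists (@KernelElt _ _ _ (f 2%N) y fy0).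
- by case=> [|n] // [nm]; apply: f_surj; rewrite nm.
Qed.

Lemma exact_sequence2_short (R : pzRingType) (X : nat -> lmodType R)
    (f : forall n, {linear X n -> X n.+1}) :
  exact_sequence 2 f -> short_exact (f 0%N) (f 1%N).
Proof. by case=> f0_inj f_exact f_surj; split=> //; [exact: f_exact|exact: f_surj]. Qed.

Lemma EFin_natS (n : nat) : (n.+1%:Z)%:E = (n%:Z)%:E + 1%:E :> \bar int.
Proof. by rewrite -addn1 PoszD EFinD. Qed.

(** Matches the bound for the sequence starting at [Z], at index [j], with the one for the original
    sequence at index [j.+1]. It also covers infinite values of [d]. *)
Lemma sube_natS (x : \bar int) (n : nat) :
  x - (n%:Z)%:E = x + 1%:E - (n.+1%:Z)%:E.
Proof. by case: x => //= r; rewrite -!EFinD; congr EFin; lia. Qed.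

Lemma d1_tilde_exact_sequence (R : pzRingType) (d : lmodType R -> \bar int)
    (i : nat) (X : nat -> lmodType R)
    (f : forall n, {linear X n -> X n.+1}) :
  cond_d1_tilde d -> exact_sequence i.+2 f ->
  (forall j, (j <= i)%N -> d (X 0%N) - (j%:Z)%:E < d (X j.+1)) ->
  d (X i.+2) + (i%:Z)%:E + 1%:E <= d (X 0%N).
Proof.
move=> d1; elim: i X f => [|i IHi] X f X_exact ltKL.
  rewrite adde0; apply: d1 (exact_sequence2_short X_exact) _.
  by have := ltKL 0%N isT; rewrite sube0.
have [Z [p [e [KLZ Z_exact]]]] := exact_sequence_split X_exact.
have ltKL0 : d (X 0%N) < d (X 1%N) by have := ltKL 0%N isT; rewrite sube0.
have leZK := d1 _ _ _ _ _ KLZ ltKL0.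
have {}IHi : d (X i.+3) + (i%:Z)%:E + 1%:E <= d Z.
  apply: (IHi _ _ Z_exact) => j le_ji; have := ltKL j.+1 le_ji => /=.
  (* Since d(Z) + 1 <= d(K), we get d(Z) - j = d(Z) + 1 - (j + 1) <= d(K) - (j + 1). *)
  by apply: le_lt_trans; rewrite sube_natS; exact: leeD2r.
apply: le_trans leZK; rewrite EFin_natS addeA.
exact: leeD2r.
Qed.

Lemma d1_exact_sequence (R : pzRingType) (d : lmodType R -> \bar int)
    (i : nat) (X : nat -> lmodType R)
    (f : forall n, {linear X n -> X n.+1}) :
  cond_d1 d -> exact_sequence i.+2 f ->
  (forall j, (j <= i)%N -> d (X 0%N) - (j%:Z)%:E < d (X j.+1)) ->
  d (X 0%N) = d (X i.+2) + (i%:Z)%:E + 1%:E.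
Proof.
move=> d1; elim: i X f => [|i IHi] X f X_exact ltKL.
  rewrite adde0; apply: d1 (exact_sequence2_short X_exact) _.
  by have := ltKL 0%N isT; rewrite sube0.
have [Z [p [e [KLZ Z_exact]]]] := exact_sequence_split X_exact.
have ltKL0 : d (X 0%N) < d (X 1%N) by have := ltKL 0%N isT; rewrite sube0.
have KZ := d1 _ _ _ _ _ KLZ ltKL0.
(* With d(K) = d(Z) + 1 an equality, both the goal and the bounds pass to [Z] by rewriting. *)
rewrite KZ EFin_natS addeA; congr (_ + _).
apply: (IHi _ _ Z_exact) => j le_ji.
by have := ltKL j.+1 le_ji; rewrite KZ -sube_natS.
Qed.

(** The order is reversed here: (d2) compares the middle term with the right end, so d(Z) must first
    be computed from the truncated sequence. Its value d(N) + i, for the full length i >= 1, is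
    exactly the bound assumed on the first middle term at j = 0. *)
Lemma d2_exact_sequence (R : pzRingType) (d : lmodType R -> \bar int)
    (i : nat) (X : nat -> lmodType R)
    (f : forall n, {linear X n -> X n.+1}) :
  cond_d2 d -> exact_sequence i.+2 f ->
  (forall j, (j <= i)%N -> d (X i.+2) + (i%:Z)%:E - (j%:Z)%:E < d (X j.+1)) ->
  d (X 0%N) = d (X i.+2) + (i%:Z)%:E + 1%:E.
Proof.
move=> d2; elim: i X f => [|i IHi] X f X_exact ltNL.
  rewrite adde0; apply: d2 (exact_sequence2_short X_exact) _.
  by have := ltNL 0%N isT; rewrite sube0 adde0.
have [Z [p [e [KLZ Z_exact]]]] := exact_sequence_split X_exact.
have ZN : d Z = d (X i.+3) + (i%:Z)%:E + 1%:E.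
  apply: (IHi _ _ Z_exact) => j le_ji.
  (* The tail is one step shorter and its indices drop by one, so the difference of the two shifts
     is unchanged. *)
  by have := ltNL j.+1 le_ji; rewrite EFin_natS addeA -sube_natS.
have {}ZN : d Z = d (X i.+3) + (i.+1%:Z)%:E.
  by rewrite ZN EFin_natS addeA.
by rewrite -ZN; apply: d2 KLZ _; have := ltNL 0%N isT; rewrite sube0 ZN.
Qed.

Theorem proposition2p1 (R : pzRingType) (d : lmodType R -> \bar int)
    (d_ge0 : forall M : lmodType R, 0 <= d M)
    (i : nat) (X : nat -> lmodType R) (f : forall n : nat, {linear X n -> X n.+1})
    (X_exact : exact_sequence i.+2 f) :
  let K := X 0%N in
  let L := fun j : nat => X j.+1 in
  let N := X i.+2 in
  [/\ cond_d1_tilde d ->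
        (forall j : nat, (j <= i)%N -> d K - (j%:Z)%:E < d (L j)) ->
        d N + (i%:Z)%:E + 1%:E <= d K,
      cond_d1 d ->
        (forall j : nat, (j <= i)%N -> d K - (j%:Z)%:E < d (L j)) ->
        d K = d N + (i%:Z)%:E + 1%:E
    & cond_d2 d ->
        (forall j : nat, (j <= i)%N -> d N + (i%:Z)%:E - (j%:Z)%:E < d (L j)) ->
        d K = d N + (i%:Z)%:E + 1%:E].
Proof.
split.
- move=> d1; exact: d1_tilde_exact_sequence d1 X_exact.
- move=> d1; exact: d1_exact_sequence d1 X_exact.
- move=> d2; exact: d2_exact_sequence d2 X_exact.
Qed.
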